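(* Let $n\geq 1$ and let $\Bbbk$ be a field whose characteristic is not $2$. There is an isomorphism of $\Bbbk$-algebras $$\Bbbk\mathrm{COD}_n\simeq\Bbbk\mathrm{O}_n\times\Bbbk\mathrm{O}_n .$$
   Context: $[n]=\{1,\dots,n\}$. $\mathrm{O}_n$ is the monoid (under composition) of all order-preserving functions $f:[n]\to[n]$ ($x_1\le x_2\Rightarrow f(x_1)\le f(x_2)$). $\mathrm{OD}_n$ is the monoid of all functions $f:[n]\to[n]$ that are order-preserving or order-reversing ($x_1\le x_2\Rightarrow f(x_1)\ge f(x_2)$). $\mathbb{Z}_2$ is the multiplicative group $\{\mathbf 1,-\mathbf 1\}$. $\mathrm{COD}_n$ is the submonoid of $\mathrm{OD}_n\times\mathbb{Z}_2$ consisting of: the pairs $(f,\mathbf 1)$ with $f$ non-constant order-preserving, the pairs $(f,-\mathbf 1)$ with $f$ non-constant order-reversing, and the pairs $(c_z,\mathbf 1)$ and $(c_z,-\mathbf 1)$ for every $z\in[n]$, where $c_z$ is the constant function with value $z$. $\Bbbk M$ denotes the monoid algebra of a monoid $M$. *)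

(* Defs.v *)
From HB Require Import structures.
From mathcomp Require Import all_boot all_order all_algebra.
From mathcomp Require Import fingroup perm alt.
From mathcomp Require Import finmap.
From mathcomp.multinomials Require Import monalg.

Set Implicit Arguments.
Unset Strict Implicit.
Unset Printing Implicit Defensive.

Import GRing.Theory.

(* Finitely supported functions M -> R with the convolution product. The       *)
(* library turns {malg R[M]} into an algebra only for monoids in which         *)
(* x * y = 1 forces x = y = 1, which excludes COD n; only its module structure *)
(* is reused here, under another name.                                         *)
Definition monoid_alg (R : nzRingType) (M : monoidType) : Type := {malg R[M]}.

Section MonoidRing.
Local Open Scope fset_scope.
Local Open Scope ring_scope.
Variables (R : nzRingType) (M : monoidType).
Implicit Types (a b c : monoid_alg R M) (x y z : M).

HB.instance Definition _ := GRing.Lmodule.copy (monoid_alg R M) {malg R[M]}.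

Definition monoid_alg_term (r : R) x : monoid_alg R M := << r *g x >>.

Definition monoid_alg_basis x : monoid_alg R M := monoid_alg_term 1 x.

Definition monoid_alg_one : monoid_alg R M := monoid_alg_basis 1%g.

Definition monoid_alg_mul a b : monoid_alg R M :=
  \sum_(x <- msupp a) \sum_(y <- msupp b)
    monoid_alg_term (a@_x * b@_y) (x * y)%g.

Lemma monoid_alg_sumE a : a = \sum_(x <- msupp a) monoid_alg_term a@_x x.
Proof. exact: (monalgE a). Qed.

Lemma monoid_alg_mulEw (d e : {fset M}) a b :
    msupp a `<=` d -> msupp b `<=` e ->
  monoid_alg_mul a b
    = \sum_(x <- d) \sum_(y <- e) monoid_alg_term (a@_x * b@_y) (x * y)%g.
Proof.
move=> ad be; rewrite /monoid_alg_mul (big_fset_incl _ ad) /=.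
  apply/eq_bigr=> x _; apply/big_fset_incl => // y _ /mcoeff_outdom ->.
  by rewrite mulr0 /monoid_alg_term monalgU0.
move=> x _ /mcoeff_outdom ax.
by rewrite big1 // => y _; rewrite ax mul0r /monoid_alg_term monalgU0.
Qed.

Lemma monoid_alg_mulUU (r s : R) x y :
  monoid_alg_mul (monoid_alg_term r x) (monoid_alg_term s y)
    = monoid_alg_term (r * s) (x * y)%g.
Proof.
by rewrite (monoid_alg_mulEw msuppU_le msuppU_le) !big_seq_fset1 !mcoeffUU.
Qed.

Fact monoid_alg_mulDl : left_distributive monoid_alg_mul +%R.
Proof.
move=> a b c; have cc := fsubset_refl (msupp c).
rewrite [in RHS](monoid_alg_mulEw (fsubsetUl _ (msupp b)) cc).
rewrite [in RHS](monoid_alg_mulEw (fsubsetUr (msupp a) _) cc).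
rewrite (monoid_alg_mulEw (msuppD_le _ _) cc) -big_split /=.
apply/eq_bigr=> x _; rewrite -big_split /=; apply/eq_bigr=> y _.
by rewrite mcoeffD mulrDl /monoid_alg_term monalgUD.
Qed.

Fact monoid_alg_mulDr : right_distributive monoid_alg_mul +%R.
Proof.
move=> c a b; have cc := fsubset_refl (msupp c).
rewrite [in RHS](monoid_alg_mulEw cc (fsubsetUl _ (msupp b))).
rewrite [in RHS](monoid_alg_mulEw cc (fsubsetUr (msupp a) _)).
rewrite (monoid_alg_mulEw cc (msuppD_le _ _)) -big_split /=.
apply/eq_bigr=> x _; rewrite -big_split /=; apply/eq_bigr=> y _.
by rewrite mcoeffD mulrDr /monoid_alg_term monalgUD.
Qed.

Let mul0a : left_zero 0 monoid_alg_mul.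
Proof. by move=> a; rewrite /monoid_alg_mul msupp0 big_seq_fset0. Qed.

Let mula0 : right_zero 0 monoid_alg_mul.
Proof.
by move=> a; rewrite /monoid_alg_mul msupp0 big1 // => x _; rewrite big_seq_fset0.
Qed.

Let mul_suml (I : Type) (s : seq I) (F : I -> monoid_alg R M) b :
  monoid_alg_mul (\sum_(i <- s) F i) b = \sum_(i <- s) monoid_alg_mul (F i) b.
Proof.
exact: (big_morph (monoid_alg_mul^~ b) (fun _ _ => monoid_alg_mulDl _ _ _)).
Qed.

Let mul_sumr (I : Type) (s : seq I) (F : I -> monoid_alg R M) b :
  monoid_alg_mul b (\sum_(i <- s) F i) = \sum_(i <- s) monoid_alg_mul b (F i).
Proof.
exact: (big_morph (monoid_alg_mul b) (fun _ _ => monoid_alg_mulDr _ _ _)).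
Qed.

Fact monoid_alg_mulA : associative monoid_alg_mul.
Proof.
move=> a b c; rewrite (monoid_alg_sumE a) [LHS]mul_suml.
rewrite [X in _ = monoid_alg_mul X c]mul_suml [RHS]mul_suml.
apply: eq_bigr => x _; rewrite (monoid_alg_sumE b) mul_suml.
rewrite !mul_sumr mul_suml; apply: eq_bigr => y _.
rewrite (monoid_alg_sumE c) !mul_sumr; apply: eq_bigr => z _.
by rewrite !monoid_alg_mulUU mulrA mulgA.
Qed.

Fact monoid_alg_mul1l : left_id monoid_alg_one monoid_alg_mul.
Proof.
move=> a; rewrite [in LHS](monoid_alg_sumE a) mul_sumr [RHS]monoid_alg_sumE.
by apply: eq_bigr => x _; rewrite monoid_alg_mulUU mul1r mul1g.
Qed.

Fact monoid_alg_mul1r : right_id monoid_alg_one monoid_alg_mul.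
Proof.
move=> a; rewrite [in LHS](monoid_alg_sumE a) mul_suml [RHS]monoid_alg_sumE.
by apply: eq_bigr => x _; rewrite monoid_alg_mulUU mulr1 mulg1.
Qed.

Fact monoid_alg_one_neq0 : monoid_alg_one != 0.
Proof. by rewrite monalgU_eq0 oner_eq0. Qed.

HB.instance Definition _ := GRing.Zmodule_isNzRing.Build (monoid_alg R M)
  monoid_alg_mulA monoid_alg_mul1l monoid_alg_mul1r
  monoid_alg_mulDl monoid_alg_mulDr monoid_alg_one_neq0.

Lemma monoid_alg_scaleU (r s : R) x :
  r *: monoid_alg_term s x = monoid_alg_term (r * s) x.
Proof. by apply/malgP => y; rewrite mcoeffZ !mcoeffU mulrnAr. Qed.

Fact monoid_alg_scaleAl (r : R) a b : r *: (a * b) = (r *: a) * b.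
Proof.
rewrite [RHS](monoid_alg_mulEw (msuppZ_le r a) (fsubset_refl _)).
rewrite scaler_sumr; apply: eq_bigr => x _.
rewrite scaler_sumr; apply: eq_bigr => y _.
by rewrite monoid_alg_scaleU mcoeffZ mulrA.
Qed.

HB.instance Definition _ :=
  GRing.Lmodule_isLalgebra.Build R (monoid_alg R M) monoid_alg_scaleAl.

Lemma monoid_alg_basisM x y :
  monoid_alg_basis x * monoid_alg_basis y = monoid_alg_basis (x * y)%g.
Proof. by rewrite [LHS]monoid_alg_mulUU mulr1. Qed.

Lemma monoid_algE a : a = \sum_(x <- msupp a) a@_x *: monoid_alg_basis x.
Proof.
rewrite {1}(monoid_alg_sumE a); apply: eq_bigr => x _.
by rewrite monoid_alg_scaleU mulr1.
Qed.

End MonoidRing.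

Section MonoidAlgebra.
Local Open Scope ring_scope.
Variables (R : comNzRingType) (M : monoidType).

Fact monoid_alg_scaleAr (r : R) (a b : monoid_alg R M) :
  r *: (a * b) = a * (r *: b).
Proof.
rewrite [RHS](monoid_alg_mulEw (fsubset_refl _) (msuppZ_le r b)).
rewrite scaler_sumr; apply: eq_bigr => x _.
rewrite scaler_sumr; apply: eq_bigr => y _.
by rewrite monoid_alg_scaleU mcoeffZ mulrCA.
Qed.

HB.instance Definition _ :=
  GRing.Lalgebra_isAlgebra.Build R (monoid_alg R M) monoid_alg_scaleAr.

End MonoidAlgebra.

(* The set [n] is represented by 'I_n = {0, ..., n-1}. As 'I_n.+1 is a group,  *)
(* {ffun 'I_n -> 'I_n} can carry the pointwise product; transf keeps the       *)
(* composition product, (f * g) x = f (g x), apart from it.                    *)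
Definition transf (n : nat) : Type := {ffun 'I_n -> 'I_n}.

Section Transformations.
Variable n : nat.
Implicit Types f g h : transf n.

HB.instance Definition _ := Finite.copy (transf n) {ffun 'I_n -> 'I_n}.

Definition transf_one : transf n := [ffun x => x].
Definition transf_mul f g : transf n := [ffun x => f (g x)].

Fact transf_mulA : associative transf_mul.
Proof. by move=> f g h; apply/ffunP => x; rewrite !ffunE. Qed.
Fact transf_mul1 : left_id transf_one transf_mul.
Proof. by move=> f; apply/ffunP => x; rewrite !ffunE. Qed.
Fact transf_mulr1 : right_id transf_one transf_mul.
Proof. by move=> f; apply/ffunP => x; rewrite !ffunE. Qed.

HB.instance Definition _ := isMonoid.Build (transf n)
  transf_mulA transf_mul1 transf_mulr1.

Lemma transfM f g (x : 'I_n) : (f * g)%g x = f (g x).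
Proof. by rewrite ffunE. Qed.

Lemma transf1 (x : 'I_n) : (1%g : transf n) x = x.
Proof. by rewrite ffunE. Qed.

Definition order_preserving f :=
  [forall x : 'I_n, forall y : 'I_n, (x <= y)%N ==> (f x <= f y)%N].

Definition order_reversing f :=
  [forall x : 'I_n, forall y : 'I_n, (x <= y)%N ==> (f y <= f x)%N].

Definition const_transf (z : 'I_n) : transf n := [ffun=> z].

Definition is_const f := [exists z, f == const_transf z].

Lemma order_preservingP f :
  reflect (forall x y : 'I_n, (x <= y)%N -> (f x <= f y)%N)
          (order_preserving f).
Proof.
apply: (iffP forallP) => [fP x y|fP x].
  by move/forallP: (fP x) => /(_ y)/implyP.
by apply/forallP => y; apply/implyP/fP.
Qed.

Lemma order_reversingP f :
  reflect (forall x y : 'I_n, (x <= y)%N -> (f y <= f x)%N)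
          (order_reversing f).
Proof.
apply: (iffP forallP) => [fP x y|fP x].
  by move/forallP: (fP x) => /(_ y)/implyP.
by apply/forallP => y; apply/implyP/fP.
Qed.

Lemma is_constP f : reflect (exists z, f = const_transf z) (is_const f).
Proof. by apply: (iffP existsP) => -[z /eqP]; exists z => //; apply/eqP. Qed.

Fact order_preserving_closed : monoid_closed order_preserving.
Proof.
split=> [|f g]; rewrite !unfold_in.
  by apply/order_preservingP => x y; rewrite !transf1.
move=> /order_preservingP fP /order_preservingP gP.
by apply/order_preservingP => x y xy; rewrite !transfM; apply/fP/gP.
Qed.

Definition order_monotone f := order_preserving f || order_reversing f.

Fact order_monotone_closed : monoid_closed order_monotone.
Proof.
split=> [|f g]; rewrite !unfold_in /order_monotone.
  by rewrite (order_preserving_closed.1 : order_preserving 1%g).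
case/orP=> [/order_preservingP|/order_reversingP] fP;
case/orP=> [/order_preservingP|/order_reversingP] gP; apply/orP.
- by left; apply/order_preservingP => x y xy; rewrite !transfM; apply/fP/gP.
- by right; apply/order_reversingP => x y xy; rewrite !transfM; apply/fP/gP.
- by right; apply/order_reversingP => x y xy; rewrite !transfM; apply/fP/gP.
- by left; apply/order_preservingP => x y xy; rewrite !transfM; apply/fP/gP.
Qed.

Record O : predArgType := MkO { O_val :> transf n; _ : order_preserving O_val }.

HB.instance Definition _ := [isSub for O_val].
HB.instance Definition _ := [Finite of O by <:].
HB.instance Definition _ := SubChoice_isSubMonoid.Build
  (transf n) order_preserving O order_preserving_closed.

Record OD : predArgType :=
  MkOD { OD_val :> transf n; _ : order_monotone OD_val }.

HB.instance Definition _ := [isSub for OD_val].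
HB.instance Definition _ := [Finite of OD by <:].
HB.instance Definition _ := SubChoice_isSubMonoid.Build
  (transf n) order_monotone OD order_monotone_closed.

(* The group {1, -1} is the library's group structure on bool, whose product   *)
(* is addb: the boolean b stands for (-1) ^+ b, so that 1 is false.            *)
Definition Z2_one : bool := false.
Definition Z2_opp_one : bool := true.

Definition COD_pred (u : OD * bool) : bool :=
  [|| [&& ~~ is_const u.1, order_preserving u.1 & u.2 == Z2_one],
      [&& ~~ is_const u.1, order_reversing u.1 & u.2 == Z2_opp_one]
    | is_const u.1].

Fact COD_pred_closed : monoid_closed COD_pred.
Proof.
have predE u : (u \in COD_pred) =
    is_const u.1 || (if u.2 then order_reversing u.1 else order_preserving u.1).
  rewrite unfold_in /COD_pred; case: u => f [] /=; case: (is_const f) => //=;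
  by rewrite ?andbT ?andbF ?orbF.
split=> [|[f s] [g t]]; rewrite !predE /=.
  by rewrite (order_preserving_closed.1 : order_preserving 1%g) orbT.
have [/is_constP[z fz] _ _|_ /= fP] := boolP (is_const f).
  apply/orP; left; apply/is_constP; exists z.
  by apply/ffunP => x; rewrite transfM fz !ffunE.
have [/is_constP[z gz] _|_ /= gP] := boolP (is_const g).
  apply/orP; left; apply/is_constP; exists (OD_val f z).
  by apply/ffunP => x; rewrite transfM gz !ffunE.
apply/orP; right.
case: s fP => /= [/order_reversingP|/order_preservingP] fP;
case: t gP => /= [/order_reversingP|/order_preservingP] gP.
- by apply/order_preservingP => x y xy; rewrite !transfM; apply/fP/gP.
- by apply/order_reversingP => x y xy; rewrite !transfM; apply/fP/gP.
- by apply/order_reversingP => x y xy; rewrite !transfM; apply/fP/gP.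
- by apply/order_preservingP => x y xy; rewrite !transfM; apply/fP/gP.
Qed.

Record COD : predArgType :=
  MkCOD { COD_val :> OD * bool; _ : COD_pred COD_val }.

HB.instance Definition _ := [isSub for COD_val].
HB.instance Definition _ := [Finite of COD by <:].
HB.instance Definition _ := SubChoice_isSubMonoid.Build
  (OD * bool)%type COD_pred COD COD_pred_closed.

End Transformations.

(* Main.v *)
Require Import Defs.
From HB Require Import structures.
From mathcomp Require Import all_boot all_order all_algebra.
From mathcomp Require Import fingroup perm.
From mathcomp Require Import finmap.
From mathcomp.multinomials Require Import monalg.

Set Implicit Arguments.
Unset Strict Implicit.
Unset Printing Implicit Defensive.

Import GRing.Theory.

Local Open Scope ring_scope.

(** The reversal r of [n] satisfies r * r = 1, and every element of COD n is
    uniquely f or f * (r, -1) with f in O n.  So k(COD n) is the skew group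
    algebra of Z/2 over k(O n), for the automorphism f |-> r f r.  The point is
    that this automorphism is inner: k(O n) contains an element u, playing the
    role of r, with u * u = 1 and u * f = (r f r) * u for all f in O n.  Then
    f |-> f, (r, -1) |-> u and f |-> f, (r, -1) |-> - u define two algebra
    morphisms from k(COD n) to k(O n), and together they form an isomorphism
    as soon as 2 is invertible.

    To find u, let every transformation of [n] act on the exterior algebra of
    k^n.  The matrix coefficients of this action are the minors
    det [g (x i) = y j], for tuples x and y of points.  Two facts are needed.

    - The action of k(O n) is faithful ([minors_separate]).  If x lists the
      least elements of the fibres of f in O n, then det [g (x i) = f (x j)]
      is 1 for g = f, and for g in O n it can only be nonzero when g >= f
      pointwise.  So the system of linear forms given by the minors is
      unitriangular on k(O n).

    - The operator of r comes from k(O n) ([realizes_perm]).  The adjacent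
      transposition (i i+1) acts as a + b - 1, where a and b in O n move only
      i to i+1, respectively only i+1 to i; and adjacent transpositions
      generate all permutations.

    An element u that acts as r then satisfies the relations above, because
    the two sides act in the same way.  More generally, every c in COD n has a
    unique [untwist c] in k(O n) that acts on the exterior algebra as the
    underlying function of c, and uniqueness makes [untwist] multiplicative. *)

(** * Linear maps out of a monoid algebra *)

Section LinearExtension.
Local Open Scope fset_scope.
Variables (R : nzRingType) (M : monoidType) (V : lmodType R) (phi : M -> V).
Implicit Types a b : monoid_alg R M.

Definition lin_ext a : V := \sum_(x <- msupp a) a@_x *: phi x.

Lemma lin_extEw (d : {fset M}) a :
  msupp a `<=` d -> lin_ext a = \sum_(x <- d) a@_x *: phi x.
Proof.
move=> ad; apply: (big_fset_incl _ ad) => x _ /mcoeff_outdom ->.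
by rewrite scale0r.
Qed.

Fact lin_ext_is_linear : linear lin_ext.
Proof.
move=> r a b; have sub := msuppD_le (r *: a) b.
rewrite (lin_extEw (fsubset_trans sub (fsetSU _ (msuppZ_le r a)))).
rewrite (lin_extEw (fsubsetUl _ (msupp b))).
rewrite (lin_extEw (fsubsetUr (msupp a) _)) scaler_sumr -big_split /=.
by apply: eq_bigr => x _; rewrite mcoeffD mcoeffZ scalerDl scalerA.
Qed.

HB.instance Definition _ :=
  GRing.isLinear.Build R (monoid_alg R M) V *:%R lin_ext lin_ext_is_linear.

Lemma lin_ext_basis x : lin_ext (monoid_alg_basis R x) = phi x.
Proof. by rewrite (lin_extEw msuppU_le) big_seq_fset1 mcoeffUU scale1r. Qed.

End LinearExtension.

Lemma lin_ext_eq (R : nzRingType) (M : monoidType) (V : lmodType R)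
    (F G : {linear monoid_alg R M -> V}) :
  (forall x, F (monoid_alg_basis R x) = G (monoid_alg_basis R x)) -> F =1 G.
Proof.
move=> FG a; rewrite (monoid_algE a) !linear_sum.
by apply: eq_bigr => x _; rewrite !linearZ /= FG.
Qed.

Lemma monoid_alg_lift (R : comNzRingType) (M : monoidType) (A : algType R)
    (phi : M -> A) :
    phi 1%g = 1 -> {morph phi : x y / (x * y)%g >-> x * y} ->
  exists F : {lrmorphism monoid_alg R M -> A},
    forall x, F (monoid_alg_basis R x) = phi x.
Proof.
move=> phi1 phiM.
have mulF : monoid_morphism (lin_ext phi).
  split=> [|a b]; first by rewrite [LHS]lin_ext_basis.
  rewrite {1}(monoid_algE a) mulr_suml linear_sum [in RHS]/lin_ext mulr_suml.
  apply: eq_bigr => x _; rewrite -scalerAl linearZ -scalerAl /=.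
  congr (_ *: _); rewrite {1}(monoid_algE b) mulr_sumr linear_sum mulr_sumr.
  apply: eq_bigr => y _; rewrite -scalerAr linearZ -scalerAr /=.
  by rewrite monoid_alg_basisM lin_ext_basis phiM.
pose mF := GRing.isMonoidMorphism.Build _ _ (lin_ext phi) mulF.
pose F : {lrmorphism monoid_alg R M -> A} := HB.pack (lin_ext phi) mF.
by exists F => x; apply: lin_ext_basis.
Qed.

(** * Minors of transformations *)

Section Minors.
Variables (R : comNzRingType) (n : nat).
Implicit Types f g h : transf n.

Definition minor p g (x y : 'I_p -> 'I_n) : R :=
  \det (\matrix_(i, j) (g (x i) == y j)%:R).

Lemma eq_minor p g h (x y : 'I_p -> 'I_n) :
  (forall i, g (x i) = h (x i)) -> minor g x y = minor h x y.
Proof.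
by move=> gh; congr (\det _); apply/matrixP => i j; rewrite !mxE gh.
Qed.

Lemma minor_comp p g f (x y : 'I_p -> 'I_n) :
  minor (g * f)%g x y = minor g (fun i => f (x i)) y.
Proof. by congr (\det _); apply/matrixP => i j; rewrite !mxE transfM. Qed.

(** The basis vector indexed by x dies in the exterior algebra once g
    identifies two of its entries. *)
Lemma minor_collapse p g (x y : 'I_p -> 'I_n) a b :
  a != b -> g (x a) = g (x b) -> minor g x y = 0.
Proof.
move=> ab gab; apply: (determinant_alternate ab) => j.
by rewrite !mxE gab.
Qed.

(** Functoriality of the exterior powers, in a form that avoids sums over
    increasing tuples: column j of the matrix of g * f is the sum of the columns
    of the matrix of f at the g-preimages of y j, and the determinant is
    expanded along all columns at once. *)
Lemma minorM p g f (x y : 'I_p -> 'I_n) :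
  minor (g * f)%g x y =
    \sum_(w : {ffun 'I_p -> 'I_n} | [forall j, g (w j) == y j]) minor f x w.
Proof.
have eqE z v : (g z == v)%:R = \sum_w (g w == v)%:R * (z == w)%:R :> R.
  rewrite (bigD1 z) //= eqxx mulr1 big1 ?addr0 // => w wz.
  by rewrite [z == w]eq_sym (negPf wz) mulr0.
(* Transposing makes the products in the Leibniz formula run over columns, so
   that distributivity produces w as a choice of one preimage per column. *)
rewrite [LHS]/minor -det_tr [LHS]/determinant.
under eq_bigr => s _.
  under eq_bigr => j _ do rewrite !mxE transfM eqE.
  rewrite bigA_distr_bigA big_distrr /=.
  over.
rewrite exchange_big [RHS]big_mkcond; apply: eq_bigr => w _ /=.
case: ifP => [/forallP gw|/negbT/forallPn[j /negPf gw]].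
  rewrite /minor -det_tr; apply: eq_bigr => s _; congr (_ * _).
  by apply: eq_bigr => j _; rewrite !mxE gw mul1r.
by rewrite big1 // => s _; rewrite (bigD1 j) //= gw !mul0r mulr0.
Qed.

Definition perm_transf (s : {perm 'I_n}) : transf n := [ffun x => s x].

Lemma perm_transfM s t :
  perm_transf (s * t)%g = (perm_transf t * perm_transf s)%g.
Proof. by apply/ffunP => x; rewrite transfM !ffunE permM. Qed.

Definition redirect (i j : 'I_n) : transf n :=
  [ffun x => if x == i then j else x].

(** If at most one of i and j occurs in x, then the transposition agrees on x
    with one redirection and the other one fixes x.  If both occur, each
    redirection kills x, and the transposition swaps two factors of a wedge
    product, hence acts as -1. *)
Lemma minor_tperm p (i j : 'I_n) (x y : 'I_p -> 'I_n) : i != j ->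
  minor (perm_transf (tperm i j)) x y =
    minor (redirect i j) x y + minor (redirect j i) x y - minor 1%g x y.
Proof.
move=> ij; case: (pickP (fun a => x a == i)) => [a /eqP xa|xi]; last first.
  rewrite (@eq_minor _ (redirect i j) 1%g) => [|c]; last first.
    by rewrite !ffunE xi.
  rewrite addrAC subrr add0r; apply: eq_minor => c; rewrite !ffunE.
  by case: tpermP => [/eqP|->|_ /eqP/negPf ->] //; rewrite ?eqxx ?xi.
case: (pickP (fun b => x b == j)) => [b /eqP xb|xj]; last first.
  rewrite (@eq_minor _ (redirect j i) 1%g) => [|c]; last first.
    by rewrite !ffunE xj.
  rewrite addrK; apply: eq_minor => c; rewrite !ffunE.
  by case: tpermP => [->|/eqP|/eqP/negPf ->] //; rewrite ?eqxx ?xj.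
have ab : a != b by apply: contraNneq ij => ab; rewrite -xa ab xb.
rewrite [minor (redirect i j) x y](minor_collapse _ ab); last first.
  by rewrite !ffunE xa xb eqxx eq_sym (negPf ij).
rewrite [minor (redirect j i) x y](minor_collapse _ ab); last first.
  by rewrite !ffunE xa xb eqxx (negPf ij).
rewrite !add0r; have [xI|] := boolP (injectiveb x); last first.
  case/injectivePn => c [d cd xcd].
  by rewrite !(minor_collapse _ cd) ?oppr0 ?xcd.
rewrite /minor -mulN1r.
have -> : -1 = (-1) ^+ tperm a b :> R by rewrite odd_tperm ab.
rewrite -det_perm -det_mulmx -row_permE.
congr (\det _); apply/matrixP => c d; rewrite !mxE !ffunE.
by rewrite (inj_tperm _ _ _ (injectiveP _ xI)) xa xb.
Qed.

End Minors.

(** * Elements that act as a given transformation *)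

Section Realization.
Variables (R : comNzRingType) (n : nat).
Implicit Types (a b : monoid_alg R (O n)) (f g h : transf n).

(** The element a and the transformation g, which need not preserve the order,
    act in the same way on the exterior algebra of R^n. *)
Definition realizes a g := forall p (x y : 'I_p -> 'I_n),
  lin_ext (fun f : O n => minor R f x y : R^o) a = minor R g x y.

Lemma realizes_basis (f : O n) : realizes (monoid_alg_basis R f) f.
Proof. by move=> p x y; rewrite lin_ext_basis. Qed.

Lemma realizesM a b g h :
  realizes a g -> realizes b h -> realizes (a * b) (g * h)%g.
Proof.
move=> ag bh p x y; rewrite minorM.
transitivity (\sum_(f <- msupp b) b@_f * minor R (g * (f : transf n))%g x y).
  rewrite {1}(monoid_algE b) mulr_sumr linear_sum; apply: eq_bigr => f _.
  rewrite -scalerAr linearZ /= minor_comp -ag; congr (_ * _).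
  rewrite {1}(monoid_algE a) mulr_suml linear_sum; apply: eq_bigr => e _.
  rewrite -scalerAl linearZ /= monoid_alg_basisM lin_ext_basis.
  by congr (_ * _); apply: minor_comp.
under eq_bigr => f _ do rewrite minorM big_distrr /=.
by rewrite exchange_big; apply: eq_bigr => w _; apply: bh.
Qed.

(** Adjacency is essential: the points between i and j would otherwise be
    jumped over. *)
Fact redirect_order_preserving (i j : 'I_n) :
  (i == j.+1 :> nat) || (j == i.+1 :> nat) -> order_preserving (redirect i j).
Proof.
move=> ij; apply/order_preservingP => x y xy; rewrite !ffunE.
have [xi | xi] := eqVneq x i; have [yi | yi] := eqVneq y i => //.
  have {}yi : (i < y)%N by rewrite ltn_neqAle -xi xy xi eq_sym yi.
  case/orP: ij => /eqP ij; last by rewrite ij.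
  by rewrite (leq_trans _ (ltnW yi)) // ij.
have {}xi : (x < i)%N by rewrite ltn_neqAle -yi xy yi xi.
case/orP: ij => /eqP ij; first by rewrite -ltnS -ij.
by rewrite ij ltnW // ltnS ltnW.
Qed.

Lemma realizes_adjacent (i j : 'I_n) : j = i.+1 :> nat ->
  exists a, realizes a (perm_transf (tperm i j)).
Proof.
move=> ji.
have ijP : order_preserving (redirect i j).
  by apply: redirect_order_preserving; rewrite ji eqxx orbT.
have jiP : order_preserving (redirect j i).
  by apply: redirect_order_preserving; rewrite ji eqxx.
exists (monoid_alg_basis R (MkO ijP) + monoid_alg_basis R (MkO jiP) - 1).
move=> p x y.
rewrite linearB linearD /= !lin_ext_basis /=.
rewrite minor_tperm //; apply/negP => /eqP ij.
by move/eqP: ji; rewrite ij -[X in X == _]addn0 -addn1 eqn_add2l.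
Qed.

Lemma realizes_perm (s : {perm 'I_n}) : exists a, realizes a (perm_transf s).
Proof.
have real1 : exists a, realizes a (perm_transf 1).
  exists (monoid_alg_basis R 1%g) => p x y; rewrite realizes_basis.
  by apply: eq_minor => i; rewrite !ffunE perm1.
have realM t u : (exists a, realizes a (perm_transf t)) ->
    (exists a, realizes a (perm_transf u)) ->
  exists a, realizes a (perm_transf (t * u)).
  move=> [a at_] [b bu]; exists (b * a).
  by rewrite perm_transfM; apply: realizesM.
(* Any transposition is a conjugate of a shorter one by an adjacent one. *)
have realT d (i j : 'I_n) : j = (i + d).+1 :> nat ->
    exists a, realizes a (perm_transf (tperm i j)).
  elim: d j => [|d IHd] j jd.
    by apply: realizes_adjacent; rewrite jd addn0.
  have l_lt : ((i + d).+1 < n)%N.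
    by rewrite (leq_trans _ (ltn_ord j)) // jd addnS.
  pose l := Ordinal l_lt.
  have [a aT] : exists a, realizes a (perm_transf (tperm l j)).
    by apply: realizes_adjacent; rewrite jd /= addnS.
  have li : l != i by rewrite -val_eqE /= -addnS -[X in _ != X]addn0 eqn_add2l.
  have ji : j != i.
    by rewrite -val_eqE /= jd -addnS -[X in _ != X]addn0 eqn_add2l.
  have -> : tperm i j = (tperm l j * (tperm i l * tperm l j))%g.
    by rewrite -{1}[tperm l j]tpermV [RHS](tpermJ i l) tpermL tpermD.
  by apply: (realM); [exists a | apply: (realM); [apply: IHd | exists a]].
have [ts -> _] := prod_tpermP s.
elim: ts => [|[i j] ts IHts]; first by rewrite big_nil.
rewrite big_cons; apply: realM => //=.
case: (ltngtP i j) => [ij|ji|/val_inj ->]; last by rewrite tperm1.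
- by apply: (realT (j - i.+1)%N); rewrite -addSn subnKC.
- by rewrite tpermC; apply: (realT (i - j.+1)%N); rewrite -addSn subnKC.
Qed.

End Realization.

(** * Faithfulness *)

(** A permutation that is monotone for y cannot lower y at i: its iterates would
    stay below y i, while one of them returns to i. *)
Lemma perm_homo_ge (T : finType) (y : T -> nat) (s : {perm T}) :
    (forall i j, (y i <= y j)%N -> (y (s i) <= y (s j))%N) ->
  forall i, (y i <= y (s i))%N.
Proof.
move=> yS i; rewrite leqNgt; apply/negP => yi.
have iterS_le m : (y ((s ^+ m.+1)%g i) <= y (s i))%N.
  elim: m => [|m IHm]; first by rewrite expg1.
  by rewrite expgSr permM; apply/yS/(leq_trans IHm)/ltnW.
have := iterS_le #[s]%g.-1.
by rewrite prednK ?order_gt0 // expg_order perm1 leqNgt yi.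
Qed.

Section Faithfulness.
Variables (R : comNzRingType) (n : nat).

Lemma minor_section (f : transf n) p (x : 'I_p -> 'I_n) :
  injective (fun i => f (x i)) -> minor R f x (fun i => f (x i)) = 1.
Proof.
move=> fxI; rewrite -(det1 R p); congr (\det _); apply/matrixP => i j.
by rewrite !mxE (inj_eq fxI).
Qed.

(** A nonzero term in the Leibniz formula is a permutation s with
    g (x i) = f (x (s i)); monotonicity of f and g makes s monotone. *)
Lemma minor_neq0_ge (f g : transf n) p (x : 'I_p -> 'I_n) :
    order_preserving f -> order_preserving g ->
    injective (fun i => f (x i)) -> minor R g x (fun i => f (x i)) != 0 ->
  forall i, (f (x i) <= g (x i))%N.
Proof.
move=> /order_preservingP fP /order_preservingP gP fxI.
pose agree (s : 'S_p) := [forall i, g (x i) == f (x (s i))].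
case: (pickP agree) => [s /forallP gf _ i|no_agree /eqP[]]; last first.
  rewrite [LHS]/minor [LHS]/determinant big1 // => s _.
  have /forallPn[i /negPf gfi] := negbT (no_agree s).
  by rewrite (bigD1 i) //= mxE gfi mul0r mulr0.
rewrite (eqP (gf i)).
apply: (perm_homo_ge (y := fun i => f (x i))) => {}i j fij.
rewrite -!(eqP (gf _)); apply: gP; rewrite leqNgt; apply/negP => xji.
have eq_ij : i = j.
  apply: fxI; apply: val_inj; apply/eqP.
  by rewrite /= eqn_leq fij /=; apply/fP/ltnW.
by rewrite eq_ij ltnn in xji.
Qed.

(** Two order-preserving functions that compare on the x i compare everywhere:
    each z lies above some x i in its own fibre, which is why minima are
    used. *)
Lemma fibre_minima (f : transf n) : exists p (x : 'I_p -> 'I_n),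
  injective (fun i => f (x i)) /\
  forall z : 'I_n, exists2 i, (x i <= z)%N & f (x i) = f z.
Proof.
pose S := [set z : 'I_n | [forall y : 'I_n, (y < z)%N ==> (f y != f z)]].
exists #|S|, enum_val; split=> [i j fij | z].
  apply: enum_val_inj; apply: val_inj.
  have Smin m : [forall y : 'I_n,
      (y < @enum_val _ (mem S) m)%N ==> (f y != f (enum_val m))].
    by have := enum_valP m; rewrite inE.
  apply/eqP; case: ltngtP => // lt_ij.
  - by have /forallP/(_ (enum_val i)) := Smin j; rewrite lt_ij fij eqxx.
  - by have /forallP/(_ (enum_val j)) := Smin i; rewrite lt_ij fij eqxx.
pose m := [arg min_(y < z | f y == f z) (y : nat)].
have [fm m_min] : f m = f z /\ forall y : 'I_n, f y = f z -> (m <= y)%N.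
  rewrite /m; case: arg_minnP => // y /eqP fy y_min.
  by split=> // w /eqP/y_min.
have mS : m \in S.
  rewrite inE; apply/forallP => y; apply/implyP; apply: contraTneq => fy.
  by rewrite -leqNgt; apply: m_min; rewrite fy.
by exists (enum_rank_in mS m); rewrite enum_rankK_in //; apply: m_min.
Qed.

(** An element of the monoid algebra is determined by its action on the exterior
    algebra. *)
Lemma minors_separate (a b : monoid_alg R (O n)) g :
  realizes a g -> realizes b g -> a = b.
Proof.
move=> ag bg; apply/eqP; rewrite -subr_eq0; set c := a - b.
have c0 p (x y : 'I_p -> 'I_n) :
    \sum_(h <- msupp c) c@_h * minor R h x y = 0.
  transitivity (lin_ext (fun h : O n => minor R h x y : R^o) c) => //.
  by rewrite linearB /= ag bg subrr.
apply/eqP/malgP => f0; rewrite mcoeff0; apply/eqP/negPn/negP => cf0.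
pose weight (h : O n) := (\sum_(z < n) O_val h z)%N.
(* Among the g in the support, f is maximal for the sum of its values; so no
   other g in the support lies pointwise above f, and the equation of the
   fibre minima of f reduces to the coefficient at f. *)
have [f cf f_max] := @arg_maxnP _ f0 (fun h => c@_h != 0) weight cf0.
have [p [x [fxI fx]]] := fibre_minima (O_val f).
have /eqP := c0 p x (fun i => O_val f (x i)); apply/negP.
rewrite (bigD1_seq f) ?fset_uniq -?mcoeff_neq0 //= minor_section // mulr1.
rewrite big1 ?addr0 // => h hf.
have [-> | ch] := eqVneq c@_h 0; first by rewrite mul0r.
have [-> | mh] := eqVneq (minor R h x (fun i => O_val f (x i))) 0.
  by rewrite mulr0.
have hP := order_preservingP _ (valP h).
have le_fh z : (O_val f z <= O_val h z)%N.
  have [i xz <-] := fx z.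
  by apply: leq_trans (minor_neq0_ge (valP f) (valP h) fxI mh i) _; apply: hP.
case/eqP: hf; apply/val_inj/ffunP => z; apply/val_inj/eqP.
have [_] : (weight f <= weight h ?= iff [forall z, O_val f z == O_val h z])%N.
  by apply: leqif_sum => y _; split; first exact: le_fh.
have le_w : (weight f <= weight h)%N by apply: leq_sum => y _.
have -> : weight f == weight h by rewrite eqn_leq le_w; apply: f_max.
by move=> /esym/forallP/(_ z); rewrite eq_sym.
Qed.

End Faithfulness.

(** * Order-reversing functions as order-preserving ones times the reversal *)

Section CODElements.
Variable n : nat.
Implicit Types c d : COD n.

Definition rev_transf : transf n := perm_transf (perm (@rev_ord_inj n)).

Lemma rev_transfE x : rev_transf x = rev_ord x.
Proof. by rewrite ffunE permE. Qed.

Lemma rev_transfK : (rev_transf * rev_transf)%g = 1%g.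
Proof. by apply/ffunP => x; rewrite transfM !rev_transfE rev_ordK ffunE. Qed.

Lemma leq_rev_transf (x y : 'I_n) :
  (rev_transf x <= rev_transf y)%N = (y <= x)%N.
Proof. by rewrite !rev_transfE leq_sub2lE. Qed.

(** Constant functions satisfy both order conditions, which is why they come
    with both signs. *)
Lemma COD_predE (u : OD n * bool) :
  COD_pred u = if u.2 then order_reversing u.1 else order_preserving u.1.
Proof.
rewrite /COD_pred; case: u => f s /=; have [cf|_] := boolP (is_const f).
  have [z fz] := is_constP _ cf; rewrite !orbT; case: s; apply/esym.
    by apply/order_reversingP => x y _; rewrite fz !ffunE.
  by apply/order_preservingP => x y _; rewrite fz !ffunE.
by case: s; rewrite ?andbT ?andbF ?orbF.
Qed.

Definition COD_fun (c : COD n) : transf n := (val c).1.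
Definition COD_sign (c : COD n) : bool := (val c).2.

Lemma COD_eq c d : COD_fun c = COD_fun d -> COD_sign c = COD_sign d -> c = d.
Proof.
case: c d => [[f s] fP] [[g t] gP]; rewrite /COD_fun /COD_sign /= => fg st.
by apply/val_inj; congr (_, _) => //; apply/val_inj.
Qed.

Fact COD_fun_monotone c :
  if COD_sign c then order_reversing (COD_fun c)
  else order_preserving (COD_fun c).
Proof. by rewrite -COD_predE; apply: valP. Qed.

Section SignedFunction.
Variables (g : transf n) (s : bool).
Hypothesis gP : if s then order_reversing g else order_preserving g.

Fact COD_of_subproof1 : order_monotone g.
Proof. by rewrite /order_monotone; case: s gP => ->; rewrite ?orbT. Qed.

Fact COD_of_subproof2 : COD_pred (MkOD COD_of_subproof1, s).
Proof. by rewrite COD_predE. Qed.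

Definition COD_of : COD n := MkCOD COD_of_subproof2.

End SignedFunction.

Definition COD_of_O (f : O n) : COD n := @COD_of f false (valP f).

Fact rev_transf_reversing : order_reversing rev_transf.
Proof. by apply/order_reversingP => x y; rewrite leq_rev_transf. Qed.

Definition COD_rev : COD n := @COD_of rev_transf true rev_transf_reversing.

Fact straighten_subproof c :
  order_preserving
    (if COD_sign c then (COD_fun c * rev_transf)%g else COD_fun c).
Proof.
have := COD_fun_monotone c; case: (COD_sign c) => // /order_reversingP cP.
by apply/order_preservingP => x y xy; rewrite !transfM cP ?leq_rev_transf.
Qed.

Definition straighten c : O n := MkO (straighten_subproof c).

Lemma straightenE c : O_val (straighten c) =
  if COD_sign c then (COD_fun c * rev_transf)%g else COD_fun c.
Proof. by []. Qed.

Lemma COD_funM c d : COD_fun (c * d)%g = (COD_fun c * COD_fun d)%g.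
Proof. by []. Qed.

Lemma COD_signM c d : COD_sign (c * d)%g = COD_sign c (+) COD_sign d.
Proof. by []. Qed.

Lemma COD_straighten c : c =
  if COD_sign c then (COD_of_O (straighten c) * COD_rev)%g
  else COD_of_O (straighten c).
Proof.
have fE f : COD_fun (COD_of_O f) = O_val f by [].
case: ifP => cs; apply: COD_eq => //; rewrite ?COD_funM fE straightenE cs //.
by rewrite -mulgA rev_transfK mulg1.
Qed.

End CODElements.

(** * The splitting of the monoid algebra *)

Section Splitting.
Variables (n : nat) (k : fieldType).
Hypothesis two_neq0 : (2%:R : k) != 0.

Let A := monoid_alg k (O n).
Let B := monoid_alg k (COD n).

Variable u : A.
Hypothesis u_rev : realizes u (rev_transf n).

(** This element acts as the function underlying c, its second factor undoing
    the reversal in [straighten c]. *)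
Definition untwist (c : COD n) : A :=
  monoid_alg_basis k (straighten c) * (if COD_sign c then u else 1).

Lemma untwistP c : realizes (untwist c) (COD_fun c).
Proof.
rewrite /untwist; case: ifP => cs; last first.
  rewrite mulr1; have := realizes_basis k (straighten c).
  by rewrite straightenE cs.
have := realizesM (realizes_basis k (straighten c)) u_rev.
by rewrite straightenE cs -mulgA rev_transfK mulg1.
Qed.

Lemma untwistM : {morph untwist : c d / (c * d)%g >-> c * d}.
Proof.
move=> c d; apply: (minors_separate (untwistP (c * d)%g)).
exact: realizesM (untwistP c) (untwistP d).
Qed.

Lemma realizes1 : realizes (1 : A) 1%g.
Proof. exact: (realizes_basis k 1%g). Qed.

Lemma untwist1 : untwist 1%g = 1.
Proof. exact: (minors_separate (untwistP 1%g) realizes1). Qed.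

Lemma untwist_O f : untwist (COD_of_O f) = monoid_alg_basis k f.
Proof.
exact: (minors_separate (untwistP (COD_of_O f)) (realizes_basis k f)).
Qed.

Lemma untwist_rev : untwist (COD_rev n) = u.
Proof. exact: (minors_separate (untwistP (COD_rev n)) u_rev). Qed.

Lemma rev_unitK : u * u = 1.
Proof.
apply: (minors_separate (realizesM u_rev u_rev)).
by rewrite rev_transfK; apply: realizes1.
Qed.

(** On J a + J b * w, where J is the inclusion of k(O n) and w = (r, -1), the
    two morphisms take the values a + b * u and a - b * u.  Half their sum and
    half their difference recover a and b * u, and u is invertible. *)
Lemma monoid_alg_COD_split :
  exists f : {lrmorphism B -> (A * A)%type}, bijective f.
Proof.
pose signed c : A := (-1) ^+ COD_sign c *: untwist c.
have signedM c d : signed (c * d)%g = signed c * signed d.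
  rewrite /signed untwistM COD_signM signr_addb.
  by rewrite -scalerAl -scalerAr scalerA.
have [F FE] : exists F : {lrmorphism B -> (A * A)%type},
    forall c, F (monoid_alg_basis k c) = (untwist c, signed c).
  apply: monoid_alg_lift => [|c d]; last by rewrite untwistM signedM.
  by rewrite /signed untwist1 scale1r.
exists F.
have [J JE] : exists J : {lrmorphism A -> B},
    forall f, J (monoid_alg_basis k f) = monoid_alg_basis k (COD_of_O f).
  apply: monoid_alg_lift => [|f g]; last rewrite monoid_alg_basisM.
    by congr (monoid_alg_basis k _); apply: COD_eq.
  by congr (monoid_alg_basis k _); apply: COD_eq.
pose w : B := monoid_alg_basis k (COD_rev n).
have FJ a : F (J a) = (a, a).
  rewrite (monoid_algE a); elim/big_ind: _ => [|b c Fb Fc|f _].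
  - by rewrite !linear0.
  - by rewrite !linearD /= Fb Fc.
  - by rewrite !linearZ /= JE FE /signed untwist_O scale1r.
have Fw : F w = (u, - u) by rewrite FE /signed untwist_rev scaleN1r.
have FJw a b : F (J a + J b * w) = (a + b * u, a - b * u).
  by rewrite rmorphD rmorphM /= !FJ Fw; congr (_, _); rewrite /= mulrN.
have Bgen c : exists a b, c = J a + J b * w.
  rewrite (monoid_algE c).
  elim/big_ind: _ => [|_ _ [a1 [b1 ->]] [a2 [b2 ->]]|d _].
  - by exists 0, 0; rewrite !rmorph0 mul0r addr0.
  - by exists (a1 + a2), (b1 + b2); rewrite !rmorphD mulrDl addrACA.
  set r := c@_d; rewrite (COD_straighten d); case: ifP => _.
  - exists 0, (r *: monoid_alg_basis k (straighten d)).
    by rewrite rmorph0 add0r linearZ /= JE -scalerAl monoid_alg_basisM.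
  - exists (r *: monoid_alg_basis k (straighten d)), 0.
    by rewrite rmorph0 mul0r addr0 linearZ /= JE.
have halfD (a b : A) : 2^-1 *: (a + b + (a - b)) = a.
  rewrite addrACA subrr addr0 -mulr2n -scaler_nat scalerA mulVf //.
  by rewrite scale1r.
have halfB (a b : A) : 2^-1 *: (a + b - (a - b)) = b.
  by rewrite opprB [a + b]addrC halfD.
pose G (y : A * A) :=
  J (2^-1 *: (y.1 + y.2)) + J (2^-1 *: (y.1 - y.2) * u) * w.
have GE a b : G (a, b) = J (2^-1 *: (a + b)) + J (2^-1 *: (a - b) * u) * w.
  by [].
(* Only the ring identities below matter from here on, not what G and w are. *)
clearbody G w.
exists G => [c | [a b]].
  have [a [b ->]] := Bgen c.
  by rewrite FJw GE halfD halfB -mulrA rev_unitK mulr1.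
rewrite GE FJw -mulrA rev_unitK mulr1 -scalerDr -scalerBr.
by rewrite halfD halfB.
Qed.

End Splitting.

Theorem theorem4p13 (n : nat) (k : fieldType)
    (hn : (1 <= n)%N) (hk : 2%N \notin [pchar k]) :
  exists f : {lrmorphism monoid_alg k (COD n) ->
                (monoid_alg k (O n) * monoid_alg k (O n))%type},
    bijective f.
Proof.
have [u u_rev] := realizes_perm k (perm (@rev_ord_inj n)).
by apply: (monoid_alg_COD_split _ u_rev); move: hk; rewrite inE.
Qed.
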